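(* Let $\tau=\{\tau_1,\dots,\tau_n\}$ be an asynchronous periodic constrained-deadline task system with $\tau_i=(O_i,C_i,D_i,T_i)$, scheduled by the global-EDF scheduler upon a platform $\pi$ consisting of $m$ identical CPUs. Let $\mathcal{S}$ be the global-EDF schedule of $\tau$ upon $\pi$ in which every job of every task $\tau_i$ has execution requirement exactly $C_i$. Let $O_{\max}=\max\{O_1,\dots,O_n\}$, $P=\operatorname{lcm}\{T_1,\dots,T_n\}$, $C_\tau=\sum_{i=1}^n C_i$ and $t_{\mathrm{up}}=O_{\max}+(C_\tau+1)\cdot P$. Then $\tau$ is schedulable by global-EDF upon $\pi$ if and only if both of the following hold: (i) in $\mathcal{S}$, all deadlines are met in $[0,t_{\mathrm{up}})$; and (ii) $C_{\mathcal{S}}(\tau,t_{\mathrm{up}}-P)=C_{\mathcal{S}}(\tau,t_{\mathrm{up}})$.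
   Context: **Task model.** All timing quantities are non-negative integers and time is discrete. A periodic constrained-deadline task $\tau_i=(O_i,C_i,D_i,T_i)$ has first release time (offset) $O_i\ge 0$, worst-case execution time $C_i$, relative deadline $D_i\le T_i$, and period $T_i\geq 1$. It generates infinitely many jobs $\tau_{i,j}$, $j\ge 1$; job $\tau_{i,j}$ is released at $O_{i,j}=O_i+(j-1)T_i$, has an execution requirement of at most $C_i$, and must complete within $[O_{i,j},d_{i,j})$, where $d_{i,j}=O_{i,j}+D_i$ is its absolute deadline. The system is synchronous if all $O_i$ are equal, and asynchronous otherwise. A job is active at time $t$ if it has been released at or before $t$ and is not yet completed. Tasks are independent; no job can execute on more than one CPU at the same time. All CPUs have the same computing capacity. Preemptions and migrations are allowed at no cost. **Scheduler.** Global-EDF is the preemptive global scheduler in which each job has a fixed priority, a job with a shorter absolute deadline having higher priority; ties are broken by a fixed rule, giving a total priority order on jobs. At each time instant the (at most $m$) highest-priority active jobs are executed. The implementation is assumed to be: - deterministic: it generates a unique schedule for any given set of jobs; - work-conserving: it never idles a CPU while there is an active job that is not running; - request-dependent: if $\tau_{i,k}$ has higher priority than $\tau_{j,\ell}$, then $\tau_{i,k+P/T_i}$ has higher priority than $\tau_{j,\ell+P/T_j}$, where $P=\operatorname{lcm}\{T_1,\dots,T_n\}$. **Schedulability.** $\tau$ is schedulable by global-EDF upon the platform if all tasks meet all their deadlines when scheduled by global-EDF (each job of $\tau_i$ having execution requirement at most $C_i$). **Configuration.** For a schedule $\mathcal{S}$ of $\tau$ and $t\ge O_{\max}$, the configuration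 $C_{\mathcal{S}}(\tau,t)$ is the $n$-tuple $(e_{1,t},\dots,e_{n,t})$, where $e_{i,t}$ is the amount of time for which task $\tau_i$ has executed since its last release time up until time $t$; $0\le e_{i,t}\le C_i$. ($e_{i,t}$ is undefined if $t<O_i$, and the configuration is undefined if some $e_{i,t}$ is.) *)

(* Defs.v *)
From mathcomp Require Import all_boot.
Set Implicit Arguments.
Unset Strict Implicit.
Unset Printing Implicit Defensive.

Record task := Task {
  offset : nat;
  wcet : nat;
  rel_deadline : nat;
  period : nat }.

Definition taskset (n : nat) := 'I_n -> task.

Definition periodic_constrained n (ts : taskset n) : Prop :=
  forall i, 0 < period (ts i) /\ rel_deadline (ts i) <= period (ts i).

Definition asynchronous n (ts : taskset n) : Prop :=
  ~ (forall i j, offset (ts i) = offset (ts j)).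

Definition Omax n (ts : taskset n) : nat := \max_(i < n) offset (ts i).
Definition hyperperiod n (ts : taskset n) : nat :=
  \big[lcmn/1]_(i < n) period (ts i).
Definition Ctau n (ts : taskset n) : nat := \sum_(i < n) wcet (ts i).
Definition tup n (ts : taskset n) : nat :=
  Omax ts + (Ctau ts).+1 * hyperperiod ts.

(* Jobs of a task are numbered from 0: (i, k) is the (k+1)-st job of task i. *)
Definition job (n : nat) : Type := ('I_n * nat)%type.

Definition release n (ts : taskset n) (j : job n) : nat :=
  offset (ts j.1) + j.2 * period (ts j.1).
Definition abs_deadline n (ts : taskset n) (j : job n) : nat :=
  release ts j + rel_deadline (ts j.1).

(* The job released exactly one hyperperiod later. *)
Definition next_hyper n (ts : taskset n) (j : job n) : job n :=
  (j.1, j.2 + hyperperiod ts %/ period (ts j.1)).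

(* [hp j1 j2] means that j1 has higher priority than j2. The priority is a
   relation on jobs only, hence is independent of the actual execution
   requirements. *)
Record edf_priority n (ts : taskset n) (hp : rel (job n)) : Prop := {
  hp_irreflexive : irreflexive hp;
  hp_transitive : transitive hp;
  hp_total : forall j1 j2, j1 != j2 -> hp j1 j2 || hp j2 j1;
  hp_deadline : forall j1 j2,
    abs_deadline ts j1 < abs_deadline ts j2 -> hp j1 j2;
  hp_request_dependent : forall j1 j2,
    hp j1 j2 -> hp (next_hyper ts j1) (next_hyper ts j2) }.

(* [S t j] means that j executes during the time slot [t, t+1). As the CPUs are
   identical and migrations are free, the CPU hosting j is not recorded; a job
   gets at most one CPU at a time because it runs at most once per slot. *)
Definition schedule (n : nat) := nat -> pred (job n).

Definition executed n (S : schedule n) (j : job n) (t : nat) : nat :=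
  \sum_(0 <= s < t) S s j.

(* Actual execution requirement of every job. *)
Definition requirement (n : nat) := job n -> nat.

Definition admissible n (ts : taskset n) (c : requirement n) : Prop :=
  forall j, c j <= wcet (ts j.1).

Definition wcet_requirement n (ts : taskset n) : requirement n :=
  fun j => wcet (ts j.1).

(* Here and in [gedf_select], [x j] is the amount of execution that j has
   received before time t. *)
Definition active n (ts : taskset n) (c : requirement n) (x : job n -> nat)
    (t : nat) (j : job n) : bool :=
  (release ts j <= t) && (x j < c j).

(* The at most m highest-priority active jobs: the active jobs preceded by fewer
   than m active jobs. Since periods are positive, a job released by time t has
   index at most t, so that counting over 'I_n * 'I_t.+1 misses no active job. *)
Definition gedf_select n (ts : taskset n) (m : nat) (hp : rel (job n))
    (c : requirement n) (x : job n -> nat) (t : nat) (j : job n) : bool :=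
  active ts c x t j &&
  (#|[set j' : 'I_n * 'I_t.+1 |
       active ts c x t (j'.1, val j'.2) && hp (j'.1, val j'.2) j]| < m).

Fixpoint gedf_executed n (ts : taskset n) (m : nat) (hp : rel (job n))
    (c : requirement n) (t : nat) : job n -> nat :=
  if t is t'.+1 then
    let x := gedf_executed ts m hp c t' in
    fun j => x j + gedf_select ts m hp c x t' j
  else fun=> 0.

(* Jobs missing their deadline stay active until completion. *)
Definition gedf n (ts : taskset n) (m : nat) (hp : rel (job n))
    (c : requirement n) : schedule n :=
  fun t => gedf_select ts m hp c (gedf_executed ts m hp c t) t.

Lemma executed_gedf n (ts : taskset n) m hp c j t :
  executed (gedf ts m hp c) j t = gedf_executed ts m hp c t j.
Proof.
rewrite /executed; elim: t => [|t IHt]; first by rewrite big_geq.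
by rewrite big_nat_recr //= IHt.
Qed.

(* Slots before d are those contained in [0, d); a global-EDF schedule never
   runs a job before its release. *)
Definition meets_deadline n (ts : taskset n) (c : requirement n)
    (S : schedule n) (j : job n) : Prop :=
  c j <= executed S j (abs_deadline ts j).

Definition schedulable n (ts : taskset n) (m : nat) (hp : rel (job n)) : Prop :=
  forall c, admissible ts c ->
  forall j, meets_deadline ts c (gedf ts m hp c) j.

(* Meaningful for offset (ts i) <= t. *)
Definition last_release n (ts : taskset n) (i : 'I_n) (t : nat) : nat :=
  release ts (i, (t - offset (ts i)) %/ period (ts i)).

(* Index range as in [gedf_select]: jobs running at s have index at most s. *)
Definition task_runs n (S : schedule n) (i : 'I_n) (s : nat) : bool :=
  [exists k : 'I_s.+1, S s (i, val k)].

(* Only used for t >= Omax ts, where every component is defined. *)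
Definition configuration n (ts : taskset n) (S : schedule n) (t : nat) :
    n.-tuple nat :=
  [tuple \sum_(last_release ts i t <= s < t) task_runs S i s | i < n].

(* Main.v *)
(** Lowering execution requirements never delays a job under a fixed job
    priority, so only the schedule [S] with requirements equal to the WCETs
    matters.  In [S], let [e i k] be the configuration at [Omax + k * P]. The
    tail of [S] after one hyperperiod simulates [S] with additional jobs, so
    [e i k] is nonincreasing in [k]; as its sum over [i] starts at most at
    [Ctau], two consecutive configurations coincide among the first [Ctau + 2].
    If no deadline has been missed by then, the whole scheduler state repeats
    and [S] is periodic from there on.

    Condition (i) leaves out the deadlines equal to [tup].  A missed one
    belongs to a task with a positive WCET that, in view of (ii), releases a
    job at every [Omax + k * P], so the sum of the [e i 0] is less than [Ctau] and two
    consecutive configurations already coincide before the last hyperperiod. *)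
Require Import Defs.
From mathcomp Require Import all_boot zify.

Set Implicit Arguments.
Unset Strict Implicit.
Unset Printing Implicit Defensive.

Section GlobalEDF.

Variables (n m : nat) (ts : taskset n) (hp : rel (job n)).
Hypothesis ts_ok : periodic_constrained ts.

Local Notation P := (hyperperiod ts).
Local Notation X := (gedf_executed ts m hp (wcet_requirement ts)).
Local Notation select := (gedf_select ts m hp).
Local Notation per i := (period (ts i)).
Local Notation next := (next_hyper ts).

(** * Hyperperiod, releases and the current job of a task *)

Lemma period_gt0 i : 0 < per i. Proof. exact: (proj1 (ts_ok i)). Qed.

Lemma rel_deadline_le i : rel_deadline (ts i) <= per i.
Proof. exact: (proj2 (ts_ok i)). Qed.

Lemma hyperperiod_gt0 : 0 < P.
Proof.
apply: (big_ind (fun k => 0 < k)) => // [a b a0 b0|i _].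
  by rewrite lcmn_gt0 a0.
exact: period_gt0.
Qed.

Lemma dvdn_hyperperiod i : per i %| P.
Proof. exact: (@biglcmn_sup _ i). Qed.

Lemma hyperperiodK i : P %/ per i * per i = P.
Proof. exact/divnK/dvdn_hyperperiod. Qed.

Lemma hyperperiod_div_gt0 i : 0 < P %/ per i.
Proof.
by have := hyperperiodK i; have := hyperperiod_gt0; case: (P %/ _) => // + H; rewrite -H.
Qed.

Lemma release_next j : release ts (next j) = release ts j + P.
Proof. by rewrite /release /= mulnDl hyperperiodK addnA. Qed.

Lemma deadline_next j : abs_deadline ts (next j) = abs_deadline ts j + P.
Proof. by rewrite /abs_deadline release_next /= addnAC. Qed.

Lemma next_inj : injective next.
Proof. by move=> [i k] [i' k'] [] /= <- /addIn ->. Qed.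

Lemma index_le_release (j : job n) : j.2 <= release ts j.
Proof. by rewrite /release; have := period_gt0 j.1; nia. Qed.

Lemma release_later (i : 'I_n) k l : k < l ->
  release ts (i, k) + per i <= release ts (i, l).
Proof.
by move=> kl; rewrite /release /= -addnA leq_add2l -mulSnr leq_mul2r kl orbT.
Qed.

Lemma offset_le_Omax i : offset (ts i) <= Omax ts.
Proof. exact: (leq_bigmax i). Qed.

Definition current (t : nat) (i : 'I_n) : job n :=
  (i, (t - offset (ts i)) %/ per i).

Lemma release_current t i : offset (ts i) <= t ->
  release ts (current t i) <= t < release ts (current t i) + per i.
Proof.
move=> Ot; rewrite /release /=.
have := divn_eq (t - offset (ts i)) (per i).
have := ltn_pmod (t - offset (ts i)) (period_gt0 i).
by move: (_ %/ _ * _) (_ %% _) => q r lt_r eq_r; apply/andP; split; lia.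
Qed.

Lemma current_next t i : offset (ts i) <= t -> current (t + P) i = next (current t i).
Proof.
move=> Ot; rewrite /current /next_hyper /=; congr pair.
by rewrite -addnBAC // divnDr ?dvdn_hyperperiod.
Qed.

(** Constrained deadlines enter here: [rel_deadline] is at most [period], the least gap between
    releases of a task. *)
Lemma before_current t (j : job n) : offset (ts j.1) <= t ->
  j.2 < (current t j.1).2 -> abs_deadline ts j <= release ts (current t j.1).
Proof.
case: j => i k /= Ot; rewrite /abs_deadline => /(release_later i).
by apply: leq_trans; rewrite leq_add2l rel_deadline_le.
Qed.

Lemma after_current t (j : job n) : offset (ts j.1) <= t ->
  (current t j.1).2 < j.2 -> t < release ts j.
Proof.
case: j => i k /= Ot /(release_later i).
by apply: leq_trans; have /andP[_] := release_current Ot.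
Qed.

(** * Comparing scheduling decisions; predictability *)

Lemma active_le c x t (j : job n) : active ts c x t j -> j.2 <= t.
Proof. by case/andP => + _; apply: leq_trans; apply: index_le_release. Qed.

(* An injection of the jobs competing with [j] at [t] into those competing with
   [j'] at [t'] shows that [j] is selected at [t] if [j'] is at [t']. *)
Lemma select_mono c c' x x' t t' (f : job n -> job n) j j' :
  active ts c x t j ->
  (forall a, active ts c x t a -> hp a j ->
     active ts c' x' t' (f a) /\ hp (f a) j') ->
  (forall a b, active ts c x t a -> hp a j -> active ts c x t b -> hp b j ->
     f a = f b -> a = b) ->
  select c' x' t' j' -> select c x t j.
Proof.
move=> act_j sim f_inj /andP[_ lt_m]; apply/andP; split=> //.
apply: leq_ltn_trans lt_m.
set A := [set _ | _]; set B := [set _ | _].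
(* On [A] the image under [f] is active at [t'], so its index is at most [t'] and [inord] never
   takes its default value. *)
pose g (u : 'I_n * 'I_t.+1) : 'I_n * 'I_t'.+1 :=
  ((f (u.1, val u.2)).1, inord (f (u.1, val u.2)).2).
have gE u : u \in A ->
    ((g u).1, val (g u).2) = f (u.1, val u.2).
  rewrite inE => /andP[act_u hp_u]; rewrite /g /=.
  have [act_f _] := sim _ act_u hp_u.
  rewrite inordK ?ltnS; last exact: active_le act_f.
  by case: (f _).
have g_inj : {in A &, injective g}.
  move=> u v uA vA guv; have := gE u uA; rewrite guv gE // => fuv.
  move: uA vA; rewrite !inE => /andP[au hu] /andP[av hv].
  have := f_inj _ _ au hu av hv (esym fuv).
  by case: u v {guv fuv au hu av hv} => [i k] [i' k'] [/= -> /val_inj ->].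
rewrite -(card_in_imset g_inj); apply/subset_leq_card/subsetP => _ /imsetP[u uA ->].
rewrite inE gE //; move: uA; rewrite inE => /andP[au hu].
by have [-> ->] := sim _ au hu.
Qed.

Lemma executed_le_requirement c t j : gedf_executed ts m hp c t j <= c j.
Proof.
elim: t => [|t IHt] //=; case sel: (select _ _ _ _); last by rewrite addn0.
by case/andP: sel => /andP[_ lt_c] _; rewrite addn1.
Qed.

Lemma executed_homo c j : {homo (gedf_executed ts m hp c)^~ j : t t' / t <= t'}.
Proof.
move=> t t' /subnK <-; elim: (t' - t) => [|d IHd] //=.
exact: leq_trans IHd (leq_addr _ _).
Qed.

Lemma executed_before_release c t j :
  t <= release ts j -> gedf_executed ts m hp c t j = 0.
Proof.
elim: t => [|t IHt] //= lt_t; rewrite IHt 1?ltnW //.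
by rewrite /gedf_select /active leqNgt lt_t.
Qed.

(* Ha and Liu's predictability. *)
Lemma remaining_mono c c' : (forall j, c j <= c' j) -> forall t j,
  c j - gedf_executed ts m hp c t j <= c' j - gedf_executed ts m hp c' t j.
Proof.
move=> le_c; elim=> [|t IHt] j /=; first by rewrite !subn0.
case sel': (select c' _ t j); last by have := IHt j; lia.
(* Only equal remaining times are critical: [j] must then run under [c] too, and it does, as every
   job active under [c] is active under [c']. *)
have := IHt j; rewrite leq_eqVlt => /orP[/eqP eq_rem|]; last by lia.
suff -> : select c (gedf_executed ts m hp c t) t j by lia.
have act_sub a : active ts c (gedf_executed ts m hp c t) t a ->
    active ts c' (gedf_executed ts m hp c' t) t a.
  by rewrite /active => /andP[-> /=]; have := IHt a; lia.
apply: (select_mono (f := id)) (sel') => //.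
  by move: sel' => /andP[/andP[rel_j lt_c'] _]; rewrite /active rel_j; lia.
by move=> a /act_sub.
Qed.

(** * Met deadlines and configurations *)

(** Deadlines equal to [t] count, whereas condition (i) stops strictly before [tup]. *)
Definition on_time t :=
  forall j, abs_deadline ts j <= t -> wcet (ts j.1) <= X (abs_deadline ts j) j.

Lemma schedulable_wcet : schedulable ts m hp <-> forall t, on_time t.
Proof.
split=> [sched t j _ | ot c adm j].
  have := sched (wcet_requirement ts) (fun _ => leqnn _) j.
  by rewrite /meets_deadline executed_gedf.
rewrite /meets_deadline executed_gedf.
have := remaining_mono adm (abs_deadline ts j) j.
by have := ot _ j (leqnn _); rewrite /wcet_requirement; lia.
Qed.

Lemma on_time_le t t' : t' <= t -> on_time t -> on_time t'.
Proof. by move=> le_t ot j dj; apply: ot; apply: leq_trans le_t. Qed.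

Lemma on_time_inactive t s j : on_time t -> t <= s ->
  abs_deadline ts j <= t -> ~~ active ts (wcet_requirement ts) (X s) s j.
Proof.
move=> ot ts' dj; rewrite /active negb_and -leqNgt; apply/orP; right.
apply: leq_trans (ot j dj) _; apply: executed_homo; exact: leq_trans dj ts'.
Qed.

(** Earlier jobs of the task are due by the current release, hence complete; later ones are not yet
    released. *)
Lemma task_runs_current t s i : offset (ts i) <= t ->
  on_time (release ts (current t i)) -> release ts (current t i) <= s < t ->
  task_runs (gedf ts m hp (wcet_requirement ts)) i s =
  gedf ts m hp (wcet_requirement ts) s (current t i).
Proof.
move=> Ot ot /andP[le_s lt_t]; apply/existsP/idP => [[k run_k] | run]; last first.
  have idx : (current t i).2 < s.+1 by rewrite ltnS (active_le (proj1 (andP run))).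
  by exists (Ordinal idx).
have /andP[act _] := run_k; have /andP[/= rel_k _] := act.
have [lt_k|lt_k|eq_k] := ltngtP (val k) (current t i).2.
- have dl := before_current (j := (i, val k)) Ot lt_k.
  have := on_time_inactive ot le_s dl.
  by rewrite act.
- have := after_current (j := (i, val k)) Ot lt_k.
  by rewrite ltnNge (leq_trans rel_k (ltnW lt_t)).
- by rewrite -[current t i]/(i, (current t i).2) -eq_k.
Qed.

Lemma configurationE t i : offset (ts i) <= t ->
  on_time (release ts (current t i)) ->
  tnth (configuration ts (gedf ts m hp (wcet_requirement ts)) t) i =
  X t (current t i).
Proof.
move=> Oi ot; rewrite tnth_mktuple.
have /andP[rel_le _] := release_current Oi.
have -> : X t (current t i) =
    executed (gedf ts m hp (wcet_requirement ts)) (current t i) t.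
  by rewrite executed_gedf.
have : executed (gedf ts m hp (wcet_requirement ts)) (current t i)
    (release ts (current t i)) = 0.
  by rewrite executed_gedf executed_before_release.
rewrite /executed (big_cat_nat (leq0n _) rel_le) /= => ->; rewrite add0n.
apply: eq_big_nat => s s_in; congr nat_of_bool; exact: task_runs_current.
Qed.

(** * Progress compared one hyperperiod apart *)

Hypothesis hp_edf : edf_priority ts hp.

(** Totality turns request-dependence into an equivalence. *)
Lemma hp_next j1 j2 : hp (next j1) (next j2) = hp j1 j2.
Proof.
have [irr tr tot _ req] := hp_edf.
apply/idP/idP => [hp12|]; last exact: req.
have [eq12|/tot/orP[//|/req hp21]] := eqVneq j1 j2.
  by move: hp12; rewrite eq12 irr.
by have := tr _ _ _ hp12 hp21; rewrite irr.
Qed.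

Lemma active_next t a : X (t + P) (next a) <= X t a ->
  active ts (wcet_requirement ts) (X t) t a ->
  active ts (wcet_requirement ts) (X (t + P)) (t + P) (next a).
Proof.
move=> le_X /andP[rel_a lt_C]; rewrite /active release_next leq_add2r rel_a /=.
exact: leq_ltn_trans lt_C.
Qed.

(** By induction, [next] maps the jobs active at [t] to jobs active at [t + P], where others may
    compete as well. So [next j] runs only if [j] runs or is already ahead. *)
Lemma executed_next_le t j : X (t + P) (next j) <= X t j.
Proof.
elim: t j => [|t IHt] j.
  by rewrite executed_before_release // release_next leq_addl.
rewrite addSn /=; case sel: (select _ _ (t + P) _); last first.
  by rewrite addn0; apply: leq_trans (IHt j) (leq_addr _ _).
have := IHt j; rewrite leq_eqVlt => /orP[/eqP eq_X|]; last by lia.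
rewrite eq_X leq_add2l.
suff -> : select (wcet_requirement ts) (X t) t j by [].
apply: (select_mono (f := next)) (sel).
- move: sel => /andP[/andP[]].
  by rewrite release_next leq_add2r eq_X /active => -> -> _.
- by move=> a act_a hp_a; rewrite hp_next; split=> //; apply: active_next.
- by move=> a b _ _ _ _; apply: next_inj.
Qed.

(** * Periodicity after a repeated configuration *)

Section Periodicity.

Variable t : nat.
Hypotheses (Ot : Omax ts <= t) (ot : on_time (t + P)).
Hypothesis conf_eq : forall i, X (t + P) (current (t + P) i) = X t (current t i).

Let Oi i : offset (ts i) <= t := leq_trans (offset_le_Omax i) Ot.

Let prev (j : job n) : job n := (j.1, j.2 - P %/ per j.1).

(** A job due after [t + P] is no older than the current one at [t + P], which is the image of the
    one at [t]; so the subtraction in [prev] is exact. *)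
Let prev_spec (j : job n) : t + P < abs_deadline ts j ->
  next (prev j) = j /\ (current t j.1).2 <= (prev j).2.
Proof.
move=> dj; suff le_idx : (current (t + P) j.1).2 <= j.2.
  move: le_idx; rewrite current_next //= => le_idx.
  have le_d : P %/ per j.1 <= j.2 := leq_trans (leq_addl _ _) le_idx.
  split; first by rewrite /next_hyper /= subnK // -surjective_pairing.
  by rewrite /= leq_subRL // addnC.
rewrite leqNgt; apply/negP => /before_current.
have OtP : offset (ts j.1) <= t + P by rewrite (leq_trans (Oi _)) ?leq_addr.
by have /andP[? _] := release_current OtP; move=> /(_ OtP); lia.
Qed.

(** At [t], current jobs agree by [conf_eq] and later ones have not started. Afterwards [next] and
    [prev] inject the competitors at either instant into those at the other. *)
Lemma executed_periodic s j : t <= s -> (current t j.1).2 <= j.2 ->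
  X (s + P) (next j) = X s j.
Proof.
move=> /subnK <-; elim: (s - t) j => [|d IHd] j.
  rewrite leq_eqVlt => /orP[/eqP idx|lt_idx].
    have -> : j = current t j.1 by case: j idx => i k /= <-.
    by rewrite add0n -current_next.
  have rel_j := after_current (Oi _) lt_idx.
  by rewrite !executed_before_release // ?release_next ?leq_add2r ltnW.
move=> le_idx; rewrite !addSn /=; set s' := d + t in IHd *.
rewrite IHd //; congr (_ + nat_of_bool _).
have act_next : active ts (wcet_requirement ts) (X (s' + P)) (s' + P) (next j) =
    active ts (wcet_requirement ts) (X s') s' j.
  by rewrite /active release_next leq_add2r IHd.
(* All deadlines up to [t + P] are met, so a job still active is due later and [prev_spec]
   applies. *)
have late b : active ts (wcet_requirement ts) (X (s' + P)) (s' + P) b ->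
    next (prev b) = b /\ (current t b.1).2 <= (prev b).2.
  move=> act_b; apply: prev_spec; rewrite ltnNge; apply/negP => db.
  have le_s' : t + P <= s' + P by rewrite leq_add2r leq_addl.
  by have := on_time_inactive ot le_s' db; rewrite act_b.
apply/idP/idP => sel.
  apply: (select_mono (f := next)) (sel).
  - by rewrite -act_next; case/andP: sel.
  - move=> a act_a hp_a; rewrite hp_next; split=> //.
    by apply: active_next => //; apply: executed_next_le.
  - by move=> a b _ _ _ _; apply: next_inj.
apply: (select_mono (f := prev)) (sel).
- by rewrite act_next; case/andP: sel.
- move=> b act_b hp_b; have [bE idx_b] := late b act_b.
  rewrite -hp_next bE; split=> //.
  by move: act_b; rewrite -{1}bE /active release_next leq_add2r IHd.
- move=> a b /late[aE _] _ /late[bE _] _ eq_ab.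
  by rewrite -aE eq_ab.
Qed.

(** Induction on the job index: a job due after [t + P] behaves like its [prev], which has a smaller
    index and is due after [t]. *)
Lemma on_time_periodic s : on_time s.
Proof.
move=> j _; have [k] := ubnP j.2; elim: k j => // k IHk j lt_k.
have [dj|dj] := leqP (abs_deadline ts j) (t + P); first exact: ot.
have [jE idx] := prev_spec dj.
have lt_prev : (prev j).2 < k.
  have := hyperperiod_div_gt0 j.1; have := congr1 snd jE; rewrite /=.
  by lia.
have := IHk _ lt_prev.
have dE : abs_deadline ts j = abs_deadline ts (prev j) + P.
  by rewrite -deadline_next jE.
have le_t : t <= abs_deadline ts (prev j).
  by rewrite -(leq_add2r P) -dE ltnW.
by have := executed_periodic le_t idx; rewrite jE dE => ->.
Qed.

Lemma configuration_periodic s i : t <= s ->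
  X (s + P) (current (s + P) i) = X s (current s i).
Proof.
move=> le_s; rewrite current_next ?(leq_trans (Oi i)) // executed_periodic //=.
by rewrite leq_div2r // leq_sub2r.
Qed.

End Periodicity.

(** * Configurations one hyperperiod apart, from [Omax ts] on *)

(** Job progress is used instead of [configuration] so that monotonicity in [k] holds even if
    deadlines are missed. *)
Definition conf (k : nat) (i : 'I_n) : nat :=
  X (Omax ts + k * P) (current (Omax ts + k * P) i).

Lemma hyper_step k : Omax ts + k.+1 * P = Omax ts + k * P + P.
Proof. by rewrite mulSnr addnA. Qed.

Lemma conf_le k i : conf k.+1 i <= conf k i.
Proof.
rewrite /conf hyper_step current_next ?executed_next_le //.
exact: leq_trans (offset_le_Omax i) (leq_addr _ _).
Qed.

(** Each step without repetition lowers the sum by at least one. *)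
Lemma conf_stabilizes N : \sum_i conf 0 i < N ->
  exists2 k, k < N & forall i, conf k.+1 i = conf k i.
Proof.
move=> lt_N.
have [k /forallP eq_k|no_eq] := pickP (fun k : 'I_N => [forall i, conf k.+1 i == conf k i]).
  by exists k => // i; apply/eqP.
suff dec k : k <= N -> \sum_i conf k i + k <= \sum_i conf 0 i.
  by have := dec N (leqnn N); lia.
elim: k => [|k IHk] lt_k; first by rewrite addn0.
apply: leq_trans (IHk (ltnW lt_k)); rewrite addnS ltn_add2r.
have /negbT := no_eq (Ordinal lt_k); rewrite negb_forall => /existsP[i ne_i].
rewrite (bigD1 i) // [X in _ < X](bigD1 i) //= -addSn leq_add //.
  by rewrite ltn_neqAle ne_i conf_le.
by apply: leq_sum => i' _; apply: conf_le.
Qed.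

Lemma conf0_le i : conf 0 i <= wcet (ts i).
Proof. exact: executed_le_requirement. Qed.

Lemma sum_conf0_le : \sum_i conf 0 i <= Ctau ts.
Proof. by apply: leq_sum => i _; apply: conf0_le. Qed.

Lemma sum_conf0_lt i : 0 < wcet (ts i) ->
  release ts (current (Omax ts) i) = Omax ts -> \sum_i conf 0 i < Ctau ts.
Proof.
move=> C_gt0 rel_i; rewrite /Ctau (bigD1 i) // [X in _ < X](bigD1 i) //= -addSn.
rewrite leq_add //; last by apply: leq_sum => i' _; apply: conf0_le.
by rewrite /conf mul0n addn0 executed_before_release // rel_i.
Qed.

Lemma on_time_of_conf k : on_time (Omax ts + k.+1 * P) ->
  (forall i, conf k.+1 i = conf k i) -> forall t, on_time t.
Proof.
rewrite hyper_step => ot eq_k t.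
apply: (on_time_periodic _ ot); first exact: leq_addr.
by move=> i; have := eq_k i; rewrite /conf hyper_step.
Qed.

Lemma conf_eq_later k l : k <= l -> on_time (Omax ts + k.+1 * P) ->
  (forall i, conf k.+1 i = conf k i) -> forall i, conf l.+1 i = conf l i.
Proof.
rewrite hyper_step => le_kl ot eq_k i; rewrite /conf hyper_step.
apply: (configuration_periodic _ ot); first exact: leq_addr.
  by move=> i'; have := eq_k i'; rewrite /conf hyper_step.
by rewrite leq_add2l leq_mul2r le_kl orbT.
Qed.

Lemma release_current_hyper k i :
  release ts (current (Omax ts + k * P) i) = release ts (current (Omax ts) i) + k * P.
Proof.
elim: k => [|k IHk]; first by rewrite mul0n !addn0.
have Oi : offset (ts i) <= Omax ts + k * P.
  exact: leq_trans (offset_le_Omax i) (leq_addr _ _).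
by rewrite hyper_step current_next // release_next IHk -addnA mulSnr.
Qed.

Lemma configuration_conf k i :
  on_time (release ts (current (Omax ts + k * P) i)) ->
  tnth (configuration ts (gedf ts m hp (wcet_requirement ts)) (Omax ts + k * P)) i =
  conf k i.
Proof.
by apply: configurationE; apply: leq_trans (offset_le_Omax i) (leq_addr _ _).
Qed.

(** Settles the deadlines falling exactly on the later instant: a job of positive WCET due there is
    the image of one due a hyperperiod earlier and completed, and equal configurations transfer its
    full execution. *)
Lemma on_time_at_hyper k :
  (forall t, t < Omax ts + k.+1 * P -> on_time t) ->
  configuration ts (gedf ts m hp (wcet_requirement ts)) (Omax ts + k * P) =
  configuration ts (gedf ts m hp (wcet_requirement ts)) (Omax ts + k.+1 * P) ->
  Ctau ts <= \sum_i conf 0 i -> on_time (Omax ts + k.+1 * P).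
Proof.
have hp0 := hyperperiod_gt0; set u := Omax ts + k.+1 * P.
move=> ot conf_eq full j; rewrite leq_eqVlt => /orP[/eqP dj|lt_dj]; last first.
  exact: ot lt_dj _ (leqnn _).
set i := j.1; have Ou : offset (ts i) <= u.
  exact: leq_trans (offset_le_Omax i) (leq_addr _ _).
have Ov : offset (ts i) <= Omax ts + k * P.
  exact: leq_trans (offset_le_Omax i) (leq_addr _ _).
have [-> //|C_gt0] := posnP (wcet (ts i)).
(* A release at [u] would imply one at [Omax ts], making the initial sum less than [Ctau ts]. *)
have rel_u : release ts (current u i) < u.
  have /andP[+ _] := release_current Ou; rewrite leq_eqVlt => /orP[/eqP rel_eq|//].
  suff /(sum_conf0_lt C_gt0) : release ts (current (Omax ts) i) = Omax ts.
    by rewrite ltnNge full.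
  by move: rel_eq; rewrite release_current_hyper /u => /addIn.
have jE : j = current u i.
  have rel_j : release ts j <= u by rewrite -dj leq_addr.
  case: (ltngtP j.2 (current u i).2) => [lt_j|lt_j|eq_j].
  - by have := before_current Ou lt_j; rewrite dj leqNgt rel_u.
  - by have := after_current Ou lt_j; rewrite ltnNge rel_j.
  - by case: j @i eq_j {dj Ou Ov C_gt0 rel_u rel_j} => i' k' /= ->.
have jE' : j = next (current (Omax ts + k * P) i).
  by rewrite jE /u hyper_step current_next.
have eq_i : conf k i = conf k.+1 i.
  have := congr1 (fun c => tnth c i) conf_eq; rewrite /= !configuration_conf //.
    exact: ot.
  have /andP[le_v _] := release_current Ov; apply/ot/(leq_ltn_trans le_v).
  by rewrite /u hyper_step -[X in X < _]addn0 ltn_add2l.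
have -> : X (abs_deadline ts j) j = conf k i by rewrite dj eq_i jE.
rewrite /conf.
have dv : abs_deadline ts (current (Omax ts + k * P) i) = Omax ts + k * P.
  by apply: (@addIn P); rewrite -deadline_next -jE' dj /u hyper_step.
rewrite -{1}dv; apply: (ot (Omax ts + k * P)); last by rewrite dv.
by rewrite /u hyper_step -[X in X < _]addn0 ltn_add2l.
Qed.

End GlobalEDF.

Theorem mainTheorem1 (n m : nat) (ts : taskset n) (hp : rel (job n))
    (ts_ok : periodic_constrained ts) (ts_async : asynchronous ts)
    (hp_edf : edf_priority ts hp) :
  let S := gedf ts m hp (wcet_requirement ts) in
  schedulable ts m hp <->
  (forall j : job n, abs_deadline ts j < tup ts ->
     meets_deadline ts (wcet_requirement ts) S j) /\
  configuration ts S (tup ts - hyperperiod ts) = configuration ts S (tup ts).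
Proof.
move=> S.
have prev_tup : tup ts - hyperperiod ts = Omax ts + Ctau ts * hyperperiod ts.
  by rewrite /tup hyper_step addnK.
rewrite schedulable_wcet // prev_tup; split=> [ot | [met conf_eq]].
  split=> [j _ | ].
    by rewrite /meets_deadline executed_gedf; apply: (ot (abs_deadline ts j)).
  (* A repetition occurs at some [k <= Ctau ts], and periodicity carries it on to [tup ts]. *)
  have lt_sum : \sum_i conf m ts hp 0 i < (Ctau ts).+1.
    by rewrite ltnS sum_conf0_le.
  have [k lt_k eq_k] := conf_stabilizes ts_ok hp_edf lt_sum.
  apply: eq_from_tnth => i; rewrite !configuration_conf //.
  by apply/esym/(conf_eq_later ts_ok hp_edf _ (ot _) eq_k).
have ot t : t < tup ts -> on_time m ts hp t.
  move=> lt_t j dj; have := met j (leq_ltn_trans dj lt_t).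
  by rewrite /meets_deadline executed_gedf.
have [lt_sum|full] := ltnP (\sum_i conf m ts hp 0 i) (Ctau ts).
  (* Now [k < Ctau ts], so the repetition is complete strictly before [tup ts], where (i)
     applies. *)
  have [k lt_k eq_k] := conf_stabilizes ts_ok hp_edf lt_sum.
  apply: (on_time_of_conf ts_ok hp_edf _ eq_k); apply: ot.
  by rewrite ltn_add2l ltn_pmul2r ?hyperperiod_gt0.
(* Once the deadlines at [tup ts] are recovered, (ii) is itself the repetition, with
   [k = Ctau ts]. *)
have ot_tup : on_time m ts hp (tup ts) by apply: on_time_at_hyper.
apply: (on_time_of_conf ts_ok hp_edf ot_tup) => i.
have := congr1 (fun c => tnth c i) conf_eq; rewrite /= !configuration_conf //.
- apply: (on_time_le _ ot_tup).
  have Ou : offset (ts i) <= tup ts.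
    exact: leq_trans (offset_le_Omax _ i) (leq_addr _ _).
  by case/andP: (release_current ts_ok Ou).
- apply: (on_time_le _ ot_tup).
  have Ou : offset (ts i) <= Omax ts + Ctau ts * hyperperiod ts.
    exact: leq_trans (offset_le_Omax _ i) (leq_addr _ _).
  case/andP: (release_current ts_ok Ou) => le_v _; apply: leq_trans le_v _.
  by rewrite leq_add2l leq_mul2r leqnSn orbT.
Qed.
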